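(* Let $L$ be a nilpotent symplectic alternating algebra of dimension $2n\geq 10$ that is of maximal class (class $2n-3$). Then $L$ has a chain of characteristic ideals $$\{0\}=I_0<I_1<\cdots<I_n<I_{n-1}^{\perp}<\cdots<I_1^{\perp}<I_0^{\perp}=L$$ where for $0\leq k\leq n$, $I_k$ is isotropic of dimension $k$.
   Context: A symplectic alternating algebra (SAA) over a field $\mathbb{F}$ is a finite-dimensional vector space $L$ over $\mathbb{F}$ with a non-degenerate alternating bilinear form $(\ ,\ )$ and a bilinear product $\cdot$ satisfying $u\cdot u=0$ for all $u$ and $(u\cdot v,w)=(v\cdot w,u)$ for all $u,v,w\in L$. No associativity or Jacobi identity is assumed. For subspaces $U,V$, $UV$ is the subspace spanned by all products $uv$, $u\in U$, $v\in V$. A subspace $I$ is an ideal if $IL\leq I$; it is isotropic if $(u,v)=0$ for all $u,v\in I$. $I^{\perp}$ is the orthogonal complement of $I$ with respect to $(\ ,\ )$. An automorphism of $L$ is a bijective linear map $L\to L$ preserving both the product and the alternating form; an ideal is characteristic if it is mapped to itself by every automorphism of $L$. $L^1=L$, $L^{m+1}=L^mL$. $L$ is nilpotent if $L^{m+1}=\{0\}$ for some $m\geq 0$, and the smallest such $m$ is its (nilpotence) class. The class of a nilpotent SAA of dimension $2n\geq 6$ is at most $2n-3$; $L$ is of maximal class if its class equals $2n-3$. *)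

(* Defs.v *)
From mathcomp Require Import all_boot all_order all_algebra.

Set Implicit Arguments.
Unset Strict Implicit.
Unset Printing Implicit Defensive.

Import GRing.Theory.
Local Open Scope ring_scope.

(* Skew-symmetry of the form follows from [saa_form_alt]; it is bundled in the
   type of [saa_form] only to have [nondegenerate] and [orthov] available. *)
Record saa (F : fieldType) := SAA {
  saa_sort :> vectType F;
  saa_form : {skew_symmetric saa_sort};
  saa_mul : {bilinear saa_sort -> saa_sort -> saa_sort};
  saa_form_alt : forall u, saa_form u u = 0;
  saa_form_nondeg : nondegenerate saa_form;
  saa_mul_alt : forall u, saa_mul u u = 0;
  saa_form_cycle : forall u v w,
    saa_form (saa_mul u v) w = saa_form (saa_mul v w) u
}.

Section SAA.
Variables (F : fieldType) (L : saa F).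
Implicit Types (U V W I : {vspace L}).

(* As for [prodv] in falgebra, the span is taken over products of basis
   vectors; [saa_prodvP] shows that it is the span of all products. *)
Definition saa_prodv U V : {vspace L} :=
  <<allpairs (saa_mul L) (vbasis U) (vbasis V)>>%VS.

Lemma memv_saa_mul U V :
  {in U & V, forall u v, saa_mul L u v \in saa_prodv U V}.
Proof.
move=> u v /coord_vbasis-> /coord_vbasis->.
rewrite linear_sumlz; apply: memv_suml => i _.
rewrite linear_sumr; apply: memv_suml => j _.
rewrite linearZl_LR linearZr_LR !memvZ // memv_span //.
by apply/allpairsP; exists ((vbasis U)`_i, (vbasis V)`_j); rewrite !memt_nth.
Qed.

Lemma saa_prodvP U V W :
  reflect {in U & V, forall u v, saa_mul L u v \in W} (saa_prodv U V <= W)%VS.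
Proof.
apply: (iffP idP) => [sUVW u v Uu Vv | sUVW].
  by rewrite (subvP sUVW) ?memv_saa_mul.
apply/span_subvP=> _ /allpairsP[[u v] /= [Uu Vv ->]].
by rewrite sUVW ?vbasis_mem.
Qed.

(* [saa_pow m] is L^m for 0 < m; the value L at m = 0 is a dummy. *)
Definition saa_pow (m : nat) : {vspace L} :=
  iter m.-1 (fun U => saa_prodv U fullv) fullv.

Definition nilpotent_saa : Prop := exists m : nat, saa_pow m.+1 = 0%VS.

Definition nilpotency_class (c : nat) : Prop :=
  saa_pow c.+1 = 0%VS /\ forall m, saa_pow m.+1 = 0%VS -> (c <= m)%N.

Definition is_ideal I : Prop := (saa_prodv I fullv <= I)%VS.

Definition isotropic I : Prop := {in I &, forall u v, saa_form L u v = 0}.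

Definition perp I : {vspace L} := orthov (saa_form L) I.

Definition is_automorphism (f : 'End(L)) : Prop :=
  [/\ bijective f,
      forall u v, f (saa_mul L u v) = saa_mul L (f u) (f v) &
      forall u v, saa_form L (f u) (f v) = saa_form L u v].

Definition characteristic_ideal I : Prop :=
  is_ideal I /\ forall f : 'End(L), is_automorphism f -> (f @: I)%VS = I.

Definition proper_subspace U V : Prop := (U <= V)%VS /\ U <> V.

End SAA.

(* Main.v *)
Require Import Defs.
From mathcomp Require Import all_boot all_order all_algebra.
From mathcomp Require Import zify.
Import GRing.Theory.
Local Open Scope ring_scope.

Set Implicit Arguments.
Unset Strict Implicit.
Unset Printing Implicit Defensive.

(** Write c = 2n-3 for the class and L^k for the lower central series. The
    trilinear map (uv, w) is alternating, so a factor can be moved across the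
    form: UV is orthogonal to W iff VW is orthogonal to U ([prodv_perp]). Hence
    (L^i, L^j) and (L^(i+j-1), L) vanish together, that is, L^i and L^j are
    orthogonal iff i + j >= c + 2 ([pow_perpE]).

    This determines the dimensions of the L^k ([dim_pow]). The c = 2n-3
    factors L^k / L^(k+1) are nonzero and their dimensions add up to 2n, which
    leaves an excess of 3 over dimension 1. There are three places where
    dimension 1 is excluded, always because an alternating map on a line
    vanishes: the first factor ([dim_pow2]), dually the last one
    ([dim_pow_last]), and the factor L^(n-1) / L^n ([dim_pow_mid]), on which
    the form induces a nonzero alternating form. So these three factors are
    planes, all others are lines, and L^k and L^(2n-1-k) are orthogonal
    complements of each other ([perp_pow]).

    The nonzero L^k with k >= n are thus isotropic of dimensions 2, ..., n-1,
    and what is left to find are invariant subspaces of dimensions 1 and n.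
    Any line I_1 <= L^c is an isotropic ideal, since L^c L = 0, and so is any
    I_n of dimension n between L^n and L^(n-1), since L^(n-1) L = L^n is
    orthogonal to L^(n-1) and is a hyperplane of I_n.
    Both are obtained from products U'V' in which U' and V' exceed smaller
    terms U and V by one dimension, while UV' and U'V are already known: such
    a product contributes at most one new dimension ([dim_prodv_codim1]).
    - I_1 = L^(2n-5) L^2, where L^(2n-4) L^2 = L^(2n-5) L^3 = 0. The factors
      L^(2n-5) / L^(2n-4) and L^2 / L^3 are lines because n >= 5.
    - I_n = L^n + L^(n-2) U, where U runs through the orthogonal complements
      of I_0, ..., I_(n-1), a flag with steps of dimension 1 from L down to
      L^(n-1), and is the smallest one with L^(n-2) U not contained in L^n.
      It exists since L^(n-2) L = L^(n-1) is not contained in L^n, whereas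
      L^(n-2) L^(n-1) is. *)

(** * Alternating products and orthogonal complements *)

Section Products.
Variables (F : fieldType) (L : saa F).
Implicit Types (U V W S : {vspace L}) (u v w : L) (i j k m : nat).

Local Notation "U ** V" := (saa_prodv U V) (at level 40, left associativity).
Local Notation "u <*> v" := (saa_mul L u v) (at level 40).
Local Notation pow := (@saa_pow F L).

Lemma saa_mulC u v : u <*> v = - (v <*> u).
Proof.
apply/eqP; rewrite -addr_eq0; apply/eqP.
have := saa_mul_alt (u + v).
by rewrite linearDr !linearDl /= !saa_mul_alt addr0 add0r addrC.
Qed.

Lemma prodvC U V : U ** V = V ** U.
Proof.
wlog suff: U V / (U ** V <= V ** U)%VS.
  by move=> sub; apply/eqP; rewrite eqEsubv !sub.
by apply/saa_prodvP => u v Uu Vv; rewrite saa_mulC memvN memv_saa_mul.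
Qed.

Lemma prodvS U U' V V' : (U <= U')%VS -> (V <= V')%VS -> (U ** V <= U' ** V')%VS.
Proof.
move=> /subvP sU /subvP sV; apply/saa_prodvP => u v /sU Uu /sV Vv.
exact: memv_saa_mul.
Qed.

(** Both sides say that the alternating trilinear map (uv, w) vanishes on
    [U], [V] and [W]. *)
Lemma prodv_perp U V W : (U ** V <= perp W)%VS = (V ** W <= perp U)%VS.
Proof.
wlog suff: U V W / (U ** V <= perp W)%VS -> (V ** W <= perp U)%VS.
  by move=> imp; apply/idP/idP => /imp // /imp.
move=> sub; apply/saa_prodvP => v w Vv Ww; apply/mem_orthovP => u Uu.
have /(subvP sub)/mem_orthovP/(_ w Ww) := memv_saa_mul Uu Vv.
by rewrite saa_form_cycle.
Qed.

Lemma perpC U V : (U <= perp V)%VS = (V <= perp U)%VS.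
Proof. exact: orthov_sym. Qed.

Lemma perpS U V : (U <= V)%VS -> (perp V <= perp U)%VS.
Proof. by move=> sUV; rewrite perpC (subv_trans sUV) // perpC. Qed.

Lemma perp_full : perp (fullv : {vspace L}) = 0%VS.
Proof. exact/eqP/saa_form_nondeg. Qed.

Lemma perp0 : perp (0 : {vspace L}) = fullv.
Proof. exact: orthov0. Qed.

(** Each vector of a basis of [U] imposes one linear condition on [V]. *)
Lemma leq_dim_cap_perp U V : (\dim V <= \dim (V :&: perp U) + \dim U)%N.
Proof.
suff gen (s : seq L) : (\dim V <= \dim (V :&: perp <<s>>) + size s)%N.
  by have := gen (vbasis U); rewrite size_tuple (span_basis (vbasisP U)).
elim: s V => [|u s IHs] V /=; first by rewrite span_nil perp0 capvf addn0.
have le_u := leq_dim_orthov1 (saa_form L) u V.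
have le_s := IHs (V :&: perp <[u]>)%VS.
have sub : (V :&: perp <[u]> :&: perp <<s>> <= V :&: perp <<u :: s>>)%VS.
  rewrite -capvA capvS // perpC span_cons subv_add.
  by rewrite perpC capvSl /= perpC capvSr.
have := dimvS sub; rewrite /perp in le_s le_u *; lia.
Qed.

(** The bound of [leq_dim_cap_perp] on the whole space gives one inequality.
    For the other, a complement of [perp U] separates the vectors of [U], by
    nondegeneracy, so its dimension is at least that of [U]. *)
Lemma dim_perp U : (\dim (perp U) + \dim U = \dim {:L})%N.
Proof.
have le1 := leq_dim_cap_perp U fullv; rewrite capfv in le1.
have le2 := leq_dim_cap_perp (perp U)^C U.
have dimC : (\dim (perp U) + \dim (perp U)^C = \dim {:L})%N.
  by rewrite -(addv_complf (perp U)) dimv_disjoint_sum // capv_compl.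
suff cap0 : (U :&: perp (perp U)^C)%VS = 0%VS by rewrite cap0 dimv0 in le2; lia.
apply/eqP; rewrite -subv0 -perp_full -(addv_complf (perp U)) perpC subv_add.
by rewrite perpS ?capvSl //= perpC capvSr.
Qed.

Lemma perpK U : perp (perp U) = U.
Proof.
apply/esym/eqP; rewrite eqEdim perpC subvv /=.
by have := dim_perp U; have := dim_perp (perp U); lia.
Qed.

Lemma codim1_line U V :
  (U <= V)%VS -> (\dim V <= (\dim U).+1)%N -> exists x, V = (U + <[x]>)%VS.
Proof.
move=> sUV dimV; have [sVU|/subvPn[x Vx Ux]] := boolP (V <= U)%VS.
  by exists 0; apply/eqP; rewrite addv0 eqEsubv sVU.
exists x; apply/esym/eqP; rewrite eqEdim subv_add sUV -memvE Vx /=.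
apply: leq_trans dimV _; rewrite ltnNge; apply: contra Ux => le_dim.
suff /eqP-> : (U == U + <[x]>)%VS by rewrite memvE addvSr.
by rewrite eqEdim addvSl.
Qed.

(** Modulo [S], only the product of the two directions added to [U] and [V]
    survives. *)
Lemma dim_prodv_codim1 U U' V V' S :
    (U <= U')%VS -> (\dim U' <= (\dim U).+1)%N ->
    (V <= V')%VS -> (\dim V' <= (\dim V).+1)%N ->
    (U ** V' <= S)%VS -> (U' ** V <= S)%VS ->
  (\dim (S + U' ** V')%VS <= (\dim S).+1)%N.
Proof.
move=> sU dU sV dV /saa_prodvP UVS /saa_prodvP VUS.
have [a Ua] := codim1_line sU dU; have [b Vb] := codim1_line sV dV.
have a_in : a \in U' by rewrite memvE Ua addvSr.
have sub : (S + U' ** V' <= S + <[a <*> b]>)%VS.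
  rewrite subv_add addvSl /=; apply/saa_prodvP => u v.
  rewrite {1}Ua => /memv_addP[u0 Uu0 [_ /vlineP[k ->] ->]] Vv.
  move: (Vv); rewrite {1}Vb => /memv_addP[v0 Vv0 [_ /vlineP[l ->] v_def]].
  rewrite linearDl /= memvD //.
    by apply: subvP (addvSl _ _) _ _; apply: UVS.
  rewrite v_def linearDr /= memvD //.
    by apply: subvP (addvSl _ _) _ _; rewrite VUS // memvZ.
  apply: subvP (addvSr _ _) _ _.
  by rewrite linearZl_LR linearZr_LR /= !memvZ // memv_line.
apply: leq_trans (dimvS sub) (leq_trans (dimv_add_leqif _ _) _).
by rewrite dim_vline -addn1 leq_add2l leq_b1.
Qed.

(** The square of the direction added to [U] is zero. *)
Lemma prodv_codim1 U V :
  (U <= V)%VS -> (\dim V <= (\dim U).+1)%N -> (V ** V <= U ** V)%VS.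
Proof.
move=> sUV dV; have [x Vx] := codim1_line sUV dV.
have x_in : x \in V by rewrite memvE Vx addvSr.
apply/saa_prodvP => u v.
rewrite {1}Vx => /memv_addP[u0 Uu0 [_ /vlineP[k ->] ->]] Vv.
rewrite linearDl /=; apply: memvD; first exact: memv_saa_mul.
move: Vv; rewrite {1}Vx => /memv_addP[v0 Uv0 [_ /vlineP[l ->] ->]].
rewrite linearDr /=; apply: memvD.
  by rewrite saa_mulC memvN memv_saa_mul ?memvZ.
by rewrite linearZl_LR linearZr_LR /= saa_mul_alt !scaler0 mem0v.
Qed.

Lemma perp_codim1 U V :
  (U <= V)%VS -> (\dim V <= (\dim U).+1)%N -> (U <= perp V)%VS ->
  (V <= perp V)%VS.
Proof.
move=> sUV dV UpV; have [x Vx] := codim1_line sUV dV.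
have xUp : (<[x]> <= perp U)%VS.
  by rewrite perpC in UpV; apply: subv_trans UpV; rewrite Vx addvSr.
rewrite {1}Vx subv_add UpV /= perpC Vx subv_add perpC xUp /=.
by rewrite [(_ <= _)%VS]orthov11 saa_form_alt.
Qed.

(** * Lower central series *)

Lemma saa_powS m : pow m.+2 = pow m.+1 ** fullv.
Proof. by []. Qed.

Lemma saa_pow_full m : (0 < m)%N -> pow m ** fullv = pow m.+1.
Proof. by case: m. Qed.

Lemma saa_pow_sub i j : (i <= j)%N -> (pow j <= pow i)%VS.
Proof.
have step m : (pow m.+1 <= pow m)%VS.
  elim: m => [|m IHm]; first exact: subvf.
  by case: m IHm => [|m] IHm; rewrite saa_powS ?subvf // prodvS.
move=> /subnK <-; elim: (j - i)%N => [|d IHd] //.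
exact: subv_trans (step _) IHd.
Qed.

Lemma saa_pow_ideal i : (pow i ** fullv <= pow i)%VS.
Proof. by case: i => [|i]; rewrite ?subvf // -saa_powS saa_pow_sub. Qed.

(** Moving the factors [L] of [pow j.+1] across the form, one at a time, ends
    at [perp fullv], which is zero. *)
Lemma saa_pow_perp i j :
  (pow i.+1 <= perp (pow j.+1))%VS = (pow (i + j).+1 == 0)%VS.
Proof.
elim: j i => [|j IHj] i; first by rewrite perp_full subv0 addn0.
rewrite [pow j.+2]saa_powS perpC prodv_perp prodvC -saa_powS IHj addSnnS.
by [].
Qed.

Lemma prodv_eq0 U V : (U ** V == 0)%VS = (U ** fullv <= perp V)%VS.
Proof. by rewrite -subv0 -perp_full prodv_perp prodv_perp prodvC. Qed.

(** * Invariance under automorphisms *)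

Definition invariant U := forall f : 'End(L), is_automorphism f -> (f @: U)%VS = U.

Lemma automorphism_dim f U : is_automorphism f -> \dim (f @: U) = \dim U.
Proof.
case=> f_bij _ _; apply: limg_dim_eq.
by have /lker0P/eqP-> := bij_inj f_bij; rewrite capv0.
Qed.

Lemma sub_invariant U :
  (forall f : 'End(L), is_automorphism f -> (f @: U <= U)%VS) -> invariant U.
Proof.
by move=> sU f fA; apply/eqP; rewrite eqEdim sU //= automorphism_dim.
Qed.

Lemma invariant0 : invariant 0.
Proof. by move=> f _; rewrite limg0. Qed.

Lemma invariant_full : invariant fullv.
Proof. by apply: sub_invariant => f _; rewrite subvf. Qed.

Lemma invariant_add U V : invariant U -> invariant V -> invariant (U + V).
Proof. by move=> iU iV f fA; rewrite limgD iU ?iV. Qed.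

Lemma invariant_prod U V : invariant U -> invariant V -> invariant (U ** V).
Proof.
move=> iU iV; apply: sub_invariant => f fA; case: (fA) => _ fM _.
apply/subvP => _ /memv_imgP[w UVw ->]; rewrite memv_preim.
apply: subvP w UVw; apply/saa_prodvP => u v Uu Vv.
rewrite -memv_preim fM; apply: memv_saa_mul.
  by rewrite -(iU f fA) memv_img.
by rewrite -(iV f fA) memv_img.
Qed.

Lemma invariant_perp U : invariant U -> invariant (perp U).
Proof.
move=> iU; apply: sub_invariant => f fA; case: (fA) => _ _ fB.
apply/orthovP => _ u /memv_imgP[v Uv ->].
rewrite -{1}(iU f fA) => /memv_imgP[u' Uu' ->]; rewrite fB.
by move/mem_orthovP: Uv; apply.
Qed.

Lemma invariant_pow i : invariant (pow i).
Proof.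
elim: i => [|[|i] IHi]; try exact: invariant_full.
exact: invariant_prod IHi invariant_full.
Qed.

Lemma ideal_perp U : is_ideal U -> is_ideal (perp U).
Proof.
by rewrite /is_ideal => iU; rewrite prodv_perp perpK prodvC.
Qed.

Lemma characteristic_perp U : characteristic_ideal U -> characteristic_ideal (perp U).
Proof. by case=> /ideal_perp iU /invariant_perp. Qed.

Lemma characteristic_pow i : characteristic_ideal (pow i).
Proof. by split; [exact: saa_pow_ideal | exact: invariant_pow]. Qed.

(** * The dimensions of the lower central series in maximal class *)

Section MaximalClass.

Variable n : nat.
Hypothesis n_ge5 : (5 <= n)%N.
Hypothesis dimL : \dim {:L} = (2 * n)%N.
Hypothesis maxL : nilpotency_class L (2 * n - 3).

Lemma pow_eq0 i : (0 < i)%N -> (pow i == 0%VS) = (2 * n - 2 <= i)%N.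
Proof.
case: maxL => pow0 min; case: i => // i _; apply/eqP/idP => [/min|le_i].
  by lia.
apply/eqP; rewrite -subv0 -pow0 saa_pow_sub //; lia.
Qed.

Lemma pow_perpE i j : (0 < i)%N -> (0 < j)%N ->
  (pow i <= perp (pow j))%VS = (2 * n - 1 <= i + j)%N.
Proof.
case: i j => [|i] [|j] // _ _; rewrite saa_pow_perp pow_eq0 //; lia.
Qed.

Lemma pow_prod0 i j : (0 < i)%N -> (0 < j)%N -> (2 * n - 2 <= i + j)%N ->
  (pow i ** pow j = 0)%VS.
Proof.
case: i => // i _ j_gt0 le_ij; apply/eqP.
rewrite prodv_eq0 -saa_powS pow_perpE //; lia.
Qed.

Lemma dim_pow_lt k : (0 < k <= 2 * n - 3)%N -> (\dim (pow k.+1) < \dim (pow k))%N.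
Proof.
case: k => // k /andP[_ le_k]; rewrite ltnNge; apply/negP => le_dim.
have eq_pow : pow k.+2 = pow k.+1 by apply/eqP; rewrite eqEdim saa_pow_sub.
have stat d : pow (d + k).+1 = pow k.+1.
  by elim: d => // d IHd; rewrite addSn saa_powS IHd -saa_powS.
have: pow k.+1 == 0%VS by rewrite -(stat (2 * n)%N) pow_eq0 //; lia.
rewrite pow_eq0 //; lia.
Qed.

Lemma dim_pow_gap i j : (0 < i <= j)%N -> (j <= 2 * n - 2)%N ->
  (\dim (pow j) + (j - i) <= \dim (pow i))%N.
Proof.
elim: j => [|j IHj] ij jn; first lia.
have [->|ne_ij] := eqVneq i j.+1; first lia.
have := @dim_pow_lt j; have := IHj; lia.
Qed.

(** If [pow 2] had codimension 1, the square of the missing direction being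
    zero, [LL] would be contained in [pow 2 ** L]. *)
Lemma dim_pow2 : (\dim (pow 2) <= 2 * n - 2)%N.
Proof.
rewrite leqNgt; apply/negP => lt_dim.
have le_dim : (\dim {:L} <= (\dim (pow 2)).+1)%N by rewrite dimL; lia.
have /dimvS : (pow 2 <= pow 3)%VS by exact: prodv_codim1 (subvf _) le_dim.
have := @dim_pow_lt 2; lia.
Qed.

(** If the last term were a line, then, as in [dim_pow2], [LL] would be
    contained in [H ** L] for its orthogonal hyperplane [H]. Moving factors
    across the form, the last term would then be orthogonal to [L]. *)
Lemma dim_pow_last : (2 <= \dim (pow (2 * n - 3)))%N.
Proof.
rewrite ltnNge; apply/negP => lt_dim.
set c := (2 * n - 3)%N in lt_dim *.
have cE : c = (c - 2).+2 by rewrite /c; lia.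
have le_dim : (\dim {:L} <= (\dim (perp (pow c))).+1)%N.
  by have := dim_perp (pow c); lia.
have LL := prodv_codim1 (subvf _) le_dim.
have: (pow c <= perp fullv)%VS.
  rewrite cE saa_powS prodv_perp; apply: subv_trans LL _.
  by rewrite prodv_perp prodvC -saa_powS -cE perpK subvv.
rewrite perp_full subv0 pow_eq0 /c //; lia.
Qed.

(** [pow n] is orthogonal to [pow n.-1], which is not isotropic itself, so the
    form induces a nonzero alternating form on the quotient, which therefore is
    not a line. *)
Lemma dim_pow_mid : (\dim (pow n) + 2 <= \dim (pow n.-1))%N.
Proof.
rewrite leqNgt; apply/negP => lt_dim.
have sub : (pow n <= pow n.-1)%VS by rewrite saa_pow_sub // leq_pred.
have le_dim : (\dim (pow n.-1) <= (\dim (pow n)).+1)%N by lia.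
have := perp_codim1 sub le_dim; rewrite !pow_perpE //; lia.
Qed.

(** The three lower bounds at the ends and in the middle use up the whole
    difference between the dimension and the class. *)
Lemma dim_pow k : (2 <= k <= 2 * n - 3)%N ->
  \dim (pow k) = (2 * n - k - (n <= k))%N.
Proof.
move=> k_bnd; have := dim_pow_mid; have := dim_pow2; have := dim_pow_last.
case: (leqP n k) => kn /=.
  have := @dim_pow_gap 2 n.-1; have := @dim_pow_gap n k.
  have := @dim_pow_gap k (2 * n - 3)%N; lia.
have := @dim_pow_gap 2 k; have := @dim_pow_gap k n.-1.
have := @dim_pow_gap n (2 * n - 3)%N; lia.
Qed.

Lemma perp_pow i : (0 < i <= 2 * n - 2)%N -> perp (pow i) = pow (2 * n - 1 - i).
Proof.
move=> i_bnd; apply/esym/eqP; rewrite eqEdim pow_perpE; try lia.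
apply/andP; split; first lia.
have /andP[i_gt0 i_le] := i_bnd.
have [->|i_neq1] := eqVneq i 1%N; first by rewrite [perp _]perp_full dimv0.
have [->|i_neq] := eqVneq i (2 * n - 2)%N.
  have -> : (2 * n - 1 - (2 * n - 2) = 1)%N by lia.
  exact/dimvS/subvf.
have := dim_perp (pow i); rewrite dimL !dim_pow; lia.
Qed.

(** * The invariant subspaces of dimensions 1 and n *)

Definition central_line := pow (2 * n - 5) ** pow 2.

Lemma dim_central_line : \dim central_line = 1%N.
Proof.
have neq0 : central_line != 0%VS.
  rewrite prodv_eq0 saa_pow_full ?pow_perpE; lia.
apply/eqP; rewrite eqn_leq lt0n dimv_eq0 neq0 andbT.
have := @dim_prodv_codim1 (pow (2 * n - 4)) (pow (2 * n - 5)) (pow 3) (pow 2) 0.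
rewrite add0v dimv0 !dim_pow; try lia; apply; try (apply: saa_pow_sub; lia); try lia.
all: by rewrite pow_prod0 ?subvv //; lia.
Qed.

(** The last term is the orthogonal complement of [pow 2], and in the square of
    [pow 2] one factor can be lowered to [pow 3], which kills [pow (2 * n - 5)]. *)
Lemma central_line_sub : (central_line <= pow (2 * n - 3))%VS.
Proof.
have -> : (2 * n - 3 = 2 * n - 1 - 2)%N by lia.
rewrite -perp_pow; last lia.
rewrite prodv_perp; apply: (@subv_trans _ _ (pow 3 ** pow 2)%VS).
  by apply: prodv_codim1; [apply: saa_pow_sub | rewrite !dim_pow; lia].
rewrite -prodv_perp pow_prod0 ?sub0v //; lia.
Qed.

Definition low_ideal k :=
  if k is k'.+1 then (if k' is _.+1 then pow (2 * n - 1 - k) else central_line)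
  else 0%VS.

Lemma low_idealE k : (1 < k)%N -> low_ideal k = pow (2 * n - 1 - k).
Proof. by case: k => [|[]]. Qed.

Lemma dim_low_ideal k : (k < n)%N -> \dim (low_ideal k) = k.
Proof.
case: k => [|[|k]] kn; rewrite ?dimv0 ?dim_central_line // low_idealE //.
rewrite dim_pow; lia.
Qed.

Lemma low_ideal_sub k : (k.+1 < n)%N -> (low_ideal k <= low_ideal k.+1)%VS.
Proof.
case: k => [|[|k]] kn; rewrite ?sub0v //.
  by rewrite (low_idealE (isT : (1 < 2)%N)) -subnDA central_line_sub.
rewrite !low_idealE // saa_pow_sub //; lia.
Qed.

Lemma low_ideal_pow k : (k < n)%N -> (low_ideal k <= pow n)%VS.
Proof.
case: k => [|[|k]] kn; rewrite ?sub0v //.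
  apply: subv_trans central_line_sub _; apply: saa_pow_sub; lia.
rewrite !low_idealE // saa_pow_sub //; lia.
Qed.

Lemma sub_pow_last_ideal U : (U <= pow (2 * n - 3))%VS -> is_ideal U.
Proof.
move=> sU; apply: subv_trans (prodvS sU (subvv _)) _.
have -> : (2 * n - 3)%N = (2 * n - 4).+1 by lia.
rewrite -saa_powS; have /eqP-> : pow (2 * n - 4).+2 == 0%VS by rewrite pow_eq0; lia.
exact: sub0v.
Qed.

Lemma characteristic_low_ideal k : characteristic_ideal (low_ideal k).
Proof.
case: k => [|[|k]]; last exact: characteristic_pow.
  split; [exact: sub_pow_last_ideal (sub0v _) | exact: invariant0].
split; first exact: sub_pow_last_ideal central_line_sub.
by apply: invariant_prod; apply: invariant_pow.
Qed.

(** The step of the flag of orthogonal complements at which the product with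
    [pow (n - 2)] first leaves [pow n] adds exactly one dimension. *)
Lemma lagrangian_exists : exists M : {vspace L},
  [/\ (pow n <= M)%VS, (M <= pow n.-1)%VS, \dim M = n & invariant M].
Proof.
have n2 : n.-1 = (n - 2).+1 by lia.
have n1 : (n = (n - 2).+2)%N by lia.
have n2E : (n - 2 = (n - 3).+1)%N by lia.
pose P k := (k < n)%N && ~~ (pow (n - 2) ** perp (low_ideal k) <= pow n)%VS.
have P0 : exists k, P k.
  exists 0%N; rewrite /P /low_ideal perp0 n2E -saa_powS -n2E -n2.
  apply/andP; split; first lia.
  by apply/negP => /dimvS; have := dim_pow_mid; lia.
have Pn k : P k -> (k <= n)%N by case/andP => /ltnW.
case: (ex_maxnP P0 Pn) => k /andP[kn notsub] kmax.
(* The flag starts at [pow n.-1], where the product still is in [pow n]. *)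
have top : (pow (n - 2) ** perp (low_ideal n.-1) <= pow n)%VS.
  rewrite low_idealE; last lia.
  have -> : (2 * n - 1 - n.-1 = n)%N by lia.
  rewrite perp_pow; last lia.
  have -> : (2 * n - 1 - n = n.-1)%N by lia.
  by rewrite {3}n1 saa_powS -n2 prodvC prodvS ?subvf.
have k1n : (k.+1 < n)%N.
  by have [kE|] := eqVneq k n.-1; [rewrite kE top in notsub | lia].
have sub : (pow (n - 2) ** perp (low_ideal k.+1) <= pow n)%VS.
  by apply/negPn/negP => nsub; have := kmax k.+1; rewrite /P k1n nsub /=; lia.
exists (pow n + pow (n - 2) ** perp (low_ideal k))%VS.
have sub_mid : (pow n.-1 ** perp (low_ideal k) <= pow n)%VS.
  by rewrite {2}n1 saa_powS -n2 prodvS ?subvf.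
split; first exact: addvSl.
- rewrite subv_add saa_pow_sub ?leq_pred //=.
  by rewrite n2 n2E saa_powS prodvS ?subvf.
- have dn : \dim (pow n) = n.-1 by rewrite dim_pow; lia.
  have dim_le : (\dim (pow n + pow (n - 2) ** perp (low_ideal k))%VS <= n.-1.+1)%N.
    rewrite -dn; apply: dim_prodv_codim1 sub_mid sub.
    - by apply: saa_pow_sub; lia.
    - by rewrite !dim_pow; lia.
    - exact/perpS/low_ideal_sub.
    have := dim_perp (low_ideal k); have := dim_perp (low_ideal k.+1).
    by rewrite !dim_low_ideal //; lia.
  have dim_gt : (n.-1 < \dim (pow n + pow (n - 2) ** perp (low_ideal k))%VS)%N.
    rewrite -{1}dn ltnNge; apply: contra notsub => le_dim.
    suff /eqP-> : (pow n == pow n + pow (n - 2) ** perp (low_ideal k))%VS.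
      exact: addvSr.
    by rewrite eqEdim addvSl.
  lia.
- apply: invariant_add; first exact: invariant_pow.
  apply: invariant_prod; first exact: invariant_pow.
  by apply: invariant_perp; have [] := characteristic_low_ideal k.
Qed.

End MaximalClass.

Lemma proper_subspace_dim U V :
  (U <= V)%VS -> (\dim U < \dim V)%N -> proper_subspace U V.
Proof. by move=> sUV ltUV; split=> // eUV; rewrite eUV ltnn in ltUV. Qed.

End Products.

Theorem theorem3p27 (F : fieldType) (L : saa F) (n : nat)
    (hn : (10 <= 2 * n)%N)
    (hdim : \dim {:L} = (2 * n)%N)
    (hnil : nilpotent_saa L)
    (hclass : nilpotency_class L (2 * n - 3)%N) :
  exists I : nat -> {vspace L},
    [/\ [/\ I 0%N = 0%VS,
            forall k : nat, (k < n)%N -> proper_subspace (I k) (I k.+1),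
            proper_subspace (I n) (perp (I n.-1)),
            forall k : nat, (k.+1 < n)%N ->
              proper_subspace (perp (I k.+1)) (perp (I k)) &
            perp (I 0%N) = fullv],
        forall k : nat, (k <= n)%N -> characteristic_ideal (I k),
        forall k : nat, (k < n)%N -> characteristic_ideal (perp (I k)) &
        forall k : nat, (k <= n)%N -> isotropic (I k) /\ \dim (I k) = k].
Proof.
have n_ge5 : (5 <= n)%N by lia.
have [M [sM Ms dM iM]] := lagrangian_exists n_ge5 hdim hclass.
pose I k := if (k < n)%N then low_ideal L n k else M.
have Ilow k : (k < n)%N -> I k = low_ideal L n k by rewrite /I => ->.
have In : I n = M by rewrite /I ltnn.
have perpI : perp (I n.-1) = saa_pow L n.-1.
  rewrite Ilow ?low_idealE; try lia.
  rewrite (perp_pow n_ge5 hdim hclass); last lia.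
  congr (saa_pow L _); lia.
have dimI k : (k <= n)%N -> \dim (I k) = k.
  rewrite leq_eqVlt => /predU1P[->|kn]; first by rewrite In.
  by rewrite Ilow // dim_low_ideal.
have subI k : (k < n)%N -> (I k <= I k.+1)%VS.
  move=> kn; rewrite Ilow //; have [k1n|] := ltnP k.+1 n.
    by rewrite Ilow // low_ideal_sub.
  move=> nk; have -> : k.+1 = n by lia.
  by rewrite In (subv_trans _ sM) // low_ideal_pow.
(* [saa_pow L n] is orthogonal to [M], and [M] exceeds it by a line. *)
have perpM : (M <= perp M)%VS.
  apply: perp_codim1 sM _ _.
    by rewrite dM (dim_pow n_ge5 hdim hclass); lia.
  rewrite perpC (subv_trans Ms) // (perp_pow n_ge5 hdim hclass); last lia.
  by apply: saa_pow_sub; lia.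
have charI k : (k <= n)%N -> characteristic_ideal (I k).
  rewrite leq_eqVlt => /predU1P[->|kn].
    rewrite In; split=> //; apply: subv_trans (prodvS Ms (subvv _)) (subv_trans _ sM).
    have -> : n.-1 = (n - 2).+1 by lia.
    by rewrite -saa_powS; apply: saa_pow_sub; lia.
  by rewrite Ilow //; apply: characteristic_low_ideal.
exists I; split=> //.
- split; rewrite ?(Ilow 0%N) ?perp0 //; try lia.
  + by move=> k kn; apply: proper_subspace_dim; [exact: subI | rewrite !dimI // ltnW].
  + apply: proper_subspace_dim; rewrite ?perpI In // dM.
    by rewrite (dim_pow n_ge5 hdim hclass); lia.
  move=> k kn; apply: proper_subspace_dim; first exact/perpS/subI/ltnW.
  have := dim_perp (I k); have := dim_perp (I k.+1).
  by rewrite !dimI; lia.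
- by move=> k kn; apply/characteristic_perp/charI/ltnW.
move=> k kn; split; last exact: dimI.
suff /orthovP sub : (I k <= perp (I k))%VS by move=> u v Uu Vv; apply: sub.
suff sIM : (I k <= M)%VS by apply: subv_trans sIM (subv_trans perpM (perpS sIM)).
move: kn; rewrite leq_eqVlt => /predU1P[->|kn]; first by rewrite In.
by rewrite Ilow // (subv_trans _ sM) // low_ideal_pow.
Qed.
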